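(* Let $G$ be the wallpaper group of type p4, i.e. $G=\langle x,y,\rho \mid (x,y),\ x^\rho=y,\ y^\rho=x^{-1},\ \rho^4\rangle$, and let $A=\langle x,y\rangle$. For $h\in\{x,y,\rho^2\}$ let $\tau_h:G\to G$ be the map with $\tau_h(g)=g$ for $g\notin A\rho^2$ and $\tau_h(g)=g^h$ for $g\in A\rho^2$. Let $\mu_\rho:G\to G$ be the map with $\mu_\rho(g)=g$ for $g\in A\cup A\rho^2$ and $\mu_\rho(g)=g^\rho$ for $g\notin A\cup A\rho^2$. Then the weak Cayley table group $\mathcal W(G)$ is generated by $\mathcal W_0(G)$ and $\tau_x,\tau_y,\tau_{\rho^2},\mu_\rho$ (in particular these four maps lie in $\mathcal W(G)$).
   Context: Notation: $g^h=h^{-1}gh$, $(g,h)=g^{-1}h^{-1}gh$. For a group $G$, $\sim$ denotes conjugacy in $G$. The weak Cayley table group $\mathcal W(G)$ is the group (under composition) of all bijections $f:G\to G$ such that $f(g_1g_2)\sim f(g_1)f(g_2)$ for all $g_1,g_2\in G$. It contains $\operatorname{Aut}(G)$ and the inversion map $\iota:g\mapsto g^{-1}$; $\mathcal W_0(G)=\langle \operatorname{Aut}(G),\iota\rangle$. *)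

(* Defs.v *)
From mathcomp Require Import all_boot.
From mathcomp Require Import boolp classical_sets.

Set Implicit Arguments.
Unset Strict Implicit.
Unset Printing Implicit Defensive.

Local Open Scope classical_set_scope.
Local Open Scope group_scope.

Definition subgroup_generated (G : groupType) (S : set G) : set G :=
  smallest (fun H : set G => group_closed [in H]) S.

Definition right_coset (G : groupType) (A : set G) (r : G) : set G :=
  [set a * r | a in A].

Definition conjugate (G : groupType) (g1 g2 : G) : Prop :=
  exists h : G, g2 = g1 ^ h.

(* Subgroups of the group of all bijections of T under composition. Closure
   under inverses is expressed through two-sided inverse functions. *)
Definition bijection_group (T : Type) (H : set (T -> T)) : Prop :=
  [/\ forall f, H f -> bijective f,
      H id,
      forall f g, H f -> H g -> H (f \o g)
    & forall f g, H f -> cancel f g -> cancel g f -> H g].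

(* If S contains a non-bijective function, no bijection_group contains S and
   this is the set of all functions; it is meant for sets of bijections. *)
Definition bijections_generated (T : Type) (S : set (T -> T)) : set (T -> T) :=
  smallest (@bijection_group T) S.

Definition automorphisms (G : groupType) : set (G -> G) :=
  [set f | bijective f /\ {morph f : g1 g2 / g1 * g2}].
Arguments automorphisms G : clear implicits.

Definition weak_cayley_table_group (G : groupType) : set (G -> G) :=
  [set f | bijective f /\
           forall g1 g2, conjugate (f (g1 * g2)) (f g1 * f g2)].
Arguments weak_cayley_table_group G : clear implicits.

Definition trivial_weak_cayley_table_group (G : groupType) : set (G -> G) :=
  bijections_generated (automorphisms G `|` [set (fun g : G => g^-1)]).
Arguments trivial_weak_cayley_table_group G : clear implicits.

(* In a groupType, x ^ y is y^-1 * (x * y) and [~ x, y] is x^-1 * x ^ y. *)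
Definition p4_relations (G : groupType) (x y rho : G) : Prop :=
  [/\ [~ x, y] = 1, x ^ rho = y, y ^ rho = x^-1 & rho ^+ 4 = 1].

(* G is presented by the generators x, y, rho and the relations above, in the
   form of the universal property of the presentation. *)
Definition p4_presentation (G : groupType) (x y rho : G) : Prop :=
  p4_relations x y rho /\
  forall (H : groupType) (a b r : H), p4_relations a b r ->
    exists! f : G -> H,
      [/\ monoid_morphism f, f x = a, f y = b & f rho = r].

Definition tau (G : groupType) (A : set G) (rho h : G) : G -> G :=
  fun g => if g \in right_coset A (rho ^+ 2) then g ^ h else g.

Definition mu (G : groupType) (A : set G) (rho : G) : G -> G :=
  fun g => if g \in A `|` right_coset A (rho ^+ 2) then g else g ^ rho.

(* Main.v *)
(** In coordinates G is Z[i] x C4, the element [elt p k] being p rho^k. A weak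
    Cayley table map F preserves involutions, hence the coset A rho^2, hence A
    (products of two involutions) and the remaining elements (square roots of
    involutions). On A, F is additive up to units of Z[i]; its image lies in
    the ideal generated by F(1), so F(1) is a unit, and after composing with an
    automorphism F fixes 1 and i, hence all of A by comparing norms. On each
    other coset F then preserves differences up to units, so it has the form
    p |-> t + u p with u a unit. Parity arguments in A rho^2 and the squares of
    elements of A rho restrict t and u to exactly what the generators achieve. *)

From HB Require Import structures.
Require Import Defs.
From mathcomp Require Import all_boot ssralg ssrnum ssrint zmodp.
From mathcomp Require Import boolp classical_sets.
From mathcomp Require Import zify.

Set Implicit Arguments.
Unset Strict Implicit.
Unset Printing Implicit Defensive.

Local Open Scope classical_set_scope.
Local Open Scope group_scope.

(** * Integer powers in a group *)

Definition zexpg (G : groupType) (g : G) (n : int) : G :=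
  match n with Posz n => g ^+ n | Negz n => g ^- n.+1 end.

Section IntegerPowers.
Variable G : groupType.
Implicit Types (g h : G) (m n : int).

Lemma zexpgS g n : zexpg g (n + 1)%R = zexpg g n * g.
Proof.
case: n => [n|[|n]].
- by rewrite -PoszD addn1 /= expgSr.
- by rewrite /= mulVg.
- have -> : (Negz n.+1 + 1)%R = Negz n by lia.
  by rewrite /= [in RHS]expgS invgM mulgVK.
Qed.

Lemma zexpgD g m n : zexpg g (m + n)%R = zexpg g m * zexpg g n.
Proof.
elim/int_rect: n => [|n IH|n IH].
- by rewrite GRing.addr0 mulg1.
- have -> : Posz n.+1 = (Posz n + 1)%R by lia.
  by rewrite GRing.addrA !zexpgS IH mulgA.
- apply: (mulIg g); rewrite -mulgA -!zexpgS.
  have -> : (m - Posz n.+1 + 1 = m - Posz n)%R by lia.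
  by have -> : (- Posz n.+1 + 1 = - Posz n)%R by lia.
Qed.

Lemma zexpgN g n : zexpg g (- n)%R = (zexpg g n)^-1.
Proof.
by symmetry; apply: mulg1_eq; rewrite -zexpgD GRing.subrr.
Qed.

Lemma zexpgJ g h n : zexpg g n ^ h = zexpg (g ^ h) n.
Proof. by case: n => n; rewrite /= -?conjVg ?conjXg // conjVg conjXg. Qed.

Lemma zexpVg g n : zexpg g^-1 n = zexpg g (- n)%R.
Proof.
rewrite zexpgN; case: n => n /=; first by rewrite expVgn.
by rewrite expVgn.
Qed.

Lemma commute_zexpg g h m n :
  commute g h -> commute (zexpg g m) (zexpg h n).
Proof.
have zX k a b : commute a b -> commute a (zexpg b k) :> Prop.
  by move=> ab; case: k => k /=; [|apply: commuteV]; apply: commuteX.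
by move=> gh; apply/zX/commute_sym/zX/commute_sym.
Qed.

Lemma zexpg_closed (S : set G) g n : group_closed [in S] -> S g -> S (zexpg g n).
Proof.
move=> Sgp Sg.
have [S1 _] := Sgp.
have SX k : g ^+ k \in S.
  elim: k => [|k IH]; first exact: S1.
  by rewrite expgS; apply: (group_closedM Sgp) => //; apply/mem_set.
apply/set_mem; case: n => n; first exact: SX.
by apply: (group_closedV Sgp); apply: SX.
Qed.

End IntegerPowers.

(** * Exponents modulo 4 and the units of Z[i] acting on Z[i] *)

Lemma Z4_ind (P : 'Z_4 -> Prop) :
  P 0%R -> P 1%R -> P 2%R -> P 3%R -> forall k, P k.
Proof.
move=> P0 P1 P2 P3 [[|[|[|[|//]]]] k4].
- by have -> : Ordinal k4 = 0%R :> 'Z_4 by apply: val_inj.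
- by have -> : Ordinal k4 = 1%R :> 'Z_4 by apply: val_inj.
- by have -> : Ordinal k4 = 2%R :> 'Z_4 by apply: val_inj.
- by have -> : Ordinal k4 = 3%R :> 'Z_4 by apply: val_inj.
Qed.

Lemma Z4D :
  ((1 + 1 = 2 :> 'Z_4)%R * (1 + 2 = 3 :> 'Z_4)%R * (1 + 3 = 0 :> 'Z_4)%R *
   (2 + 1 = 3 :> 'Z_4)%R * (2 + 2 = 0 :> 'Z_4)%R * (2 + 3 = 1 :> 'Z_4)%R *
   (3 + 1 = 0 :> 'Z_4)%R * (3 + 2 = 1 :> 'Z_4)%R * (3 + 3 = 2 :> 'Z_4)%R)%type.
Proof. by do !split; apply: val_inj. Qed.

Lemma Z4N :
  ((- 1 = 3 :> 'Z_4)%R * (- 2 = 2 :> 'Z_4)%R * (- 3 = 1 :> 'Z_4)%R)%type.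
Proof. by do !split; apply: val_inj. Qed.

Definition Z4E := (@GRing.add0r 'Z_4, @GRing.addr0 'Z_4, @GRing.oppr0 'Z_4, Z4D, Z4N).

(* Multiplication by (-i)^k on the Gaussian integers; the presentation makes
   conjugation by rho multiplication by i. *)
Definition twist (k : 'Z_4) (p : int * int) : int * int :=
  match val k with
  | 0 => p
  | 1 => (p.2, - p.1)%R
  | 2 => (- p.1, - p.2)%R
  | _ => (- p.2, p.1)%R
  end.

Lemma twist0 p : twist 0%R p = p. Proof. by []. Qed.
Lemma twist1 p : twist 1%R p = (p.2, - p.1)%R. Proof. by []. Qed.
Lemma twist2 p : twist 2%R p = (- p.1, - p.2)%R. Proof. by []. Qed.
Lemma twist3 p : twist 3%R p = (- p.2, p.1)%R. Proof. by []. Qed.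
Definition twistE := (twist0, twist1, twist2, twist3).

Lemma addpE (p q : int * int) : (p + q = (p.1 + q.1, p.2 + q.2))%R.
Proof. by []. Qed.
Lemma oppE (p : int * int) : (- p = (- p.1, - p.2))%R.
Proof. by []. Qed.

(** Once [Z4_ind] has made all exponents literal, an identity between twisted Gaussian integers
    becomes two linear equations over the integers. *)
Ltac gauss :=
  rewrite ?Z4E ?twistE ?addpE ?oppE /=;
  try (congr (_, _); simpl in *; lia).

Lemma twistD k p q : twist k (p + q)%R = (twist k p + twist k q)%R.
Proof. by move: k; apply: Z4_ind; gauss. Qed.

Lemma twistN k p : twist k (- p)%R = (- twist k p)%R.
Proof. by move: k; apply: Z4_ind; gauss. Qed.

Lemma twistM k l p : twist (k + l)%R p = twist k (twist l p).
Proof.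
by case: p => a b; move: k l; apply: Z4_ind; apply: Z4_ind; gauss.
Qed.

(** * The concrete semidirect product of Z[i] and C4 *)

Definition p4 := ((int * int) * 'Z_4)%type.
HB.instance Definition _ := Choice.on p4.

Definition p4_mul (g h : p4) : p4 :=
  ((g.1 + twist g.2 h.1)%R, (g.2 + h.2)%R).
Definition p4_inv (g : p4) : p4 := ((- twist (- g.2) g.1)%R, (- g.2)%R).

Lemma p4_mulA : associative p4_mul.
Proof.
by move=> [p k] [q l] [r m]; rewrite /p4_mul /= twistM twistD !GRing.addrA.
Qed.
Lemma p4_mul1 : left_id ((0, 0)%R : p4) p4_mul.
Proof. by move=> [p k]; rewrite /p4_mul /= !GRing.add0r. Qed.
Lemma p4_mulr1 : right_id ((0, 0)%R : p4) p4_mul.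
Proof.
move=> [p k]; rewrite /p4_mul /= GRing.addr0; congr (_, _).
by move: k; apply: Z4_ind; case: p => a b; gauss.
Qed.
Lemma p4_mulV : left_inverse ((0, 0)%R : p4) p4_inv p4_mul.
Proof. by move=> [p k]; rewrite /p4_mul /= !GRing.addNr. Qed.
Lemma p4_mulrV : right_inverse ((0, 0)%R : p4) p4_inv p4_mul.
Proof.
by move=> [p k]; rewrite /p4_mul /= twistN -twistM !GRing.subrr.
Qed.
HB.instance Definition _ :=
  isGroup.Build p4 p4_mulA p4_mul1 p4_mulr1 p4_mulV p4_mulrV.

Lemma zexpg_p4 p n :
  zexpg ((p, 0)%R : p4) n = ((n * p.1, n * p.2), 0)%R :> p4.
Proof.
have step m : ((((m + 1) * p.1, (m + 1) * p.2), 0)%R : p4)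
            = (((m * p.1, m * p.2), 0)%R : p4) * ((p, 0)%R : p4).
  by congr (_, _); gauss.
elim/int_rect: n => [|n IH|n IH].
- by rewrite !GRing.mul0r.
- have -> : Posz n.+1 = (Posz n + 1)%R by lia.
  by rewrite zexpgS IH -step.
- apply: (mulIg ((p, 0)%R : p4)); rewrite -zexpgS -step.
  by have -> : (- Posz n.+1 + 1 = - Posz n)%R by lia.
Qed.

(** * Coordinates on the presented group *)

Section Coordinates.
Variables (G : groupType) (x y rho : G).
Hypothesis hG : p4_presentation x y rho.

Definition lattice (p : int * int) : G := zexpg x p.1 * zexpg y p.2.
Definition elt (p : int * int) (k : 'Z_4) : G := lattice p * rho ^+ k.

Let comm_xy : commute x y.
Proof. by case: hG => [[/eqP xy _ _ _] _]; apply/commgP. Qed.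

Let rho4 : rho ^+ 4 = 1. Proof. by case: hG => [[_ _ _ ->] _]. Qed.

Let expg_mod4 n : rho ^+ (n %% 4) = rho ^+ n.
Proof.
by rewrite [in RHS](divn_eq n 4) expgnDr mulnC expgnA rho4 expg1n mul1g.
Qed.

Let latticeD p q : lattice (p + q)%R = lattice p * lattice q.
Proof.
rewrite /lattice /= !zexpgD -!mulgA; congr (_ * _); rewrite !mulgA.
by congr (_ * _); apply: commute_zexpg.
Qed.

Let latticeJ p : lattice p ^ rho^-1 = lattice (twist 1%R p).
Proof.
have [[_ xr yr _] _] := hG.
have yr' : y ^ rho^-1 = x by rewrite -xr conjgK.
have xr' : x ^ rho^-1 = y^-1.
  by apply: (conjg_inj rho); rewrite conjgKV conjVg yr invgK.
rewrite /lattice conjMg !zexpgJ xr' yr' zexpVg twist1 /=.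
exact/commute_zexpg/commute_sym.
Qed.

Let expg_lattice k p : rho ^+ k * lattice p = lattice (iter k (twist 1%R) p) * rho ^+ k.
Proof.
elim: k => [|k IH]; first by rewrite mul1g mulg1.
rewrite iterS -latticeJ expgS -mulgA IH !mulgA; congr (_ * _).
by rewrite conjgE invgK !mulgA mulgVK.
Qed.

Let iter_twist (k : 'Z_4) p : iter k (twist 1%R) p = twist k p.
Proof. by case: p => a b; move: k; apply: Z4_ind; gauss. Qed.

Lemma eltM p k q l : elt p k * elt q l = elt (p + twist k q)%R (k + l)%R.
Proof.
rewrite /elt latticeD -iter_twist; have := expg_lattice k q.
move: (lattice p) (lattice q) (lattice (iter _ _ _)) => P A B e.
rewrite mulgA -[P * _ * A]mulgA e -[RHS]mulgA -!mulgA; congr (_ * (_ * _)).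
by rewrite -expgnDr -[LHS]expg_mod4.
Qed.

Definition elt_p4 (g : p4) : G := elt g.1 g.2.

Let elt_p4_morphism : monoid_morphism elt_p4.
Proof.
split; first by rewrite /elt_p4 /elt /lattice !mul1g.
by move=> [p k] [q l]; rewrite /elt_p4 eltM.
Qed.

Lemma elt_x : elt (1, 0)%R 0%R = x. Proof. by rewrite /elt /lattice !mulg1. Qed.
Lemma elt_y : elt (0, 1)%R 0%R = y. Proof. by rewrite /elt /lattice mul1g mulg1. Qed.
Lemma elt_rho : elt 0%R 1%R = rho. Proof. by rewrite /elt /lattice !mul1g. Qed.

(** The universal property yields a morphism [c] to the concrete model, whose relations hold by
    computation. The other composite is evaluated directly on x^a y^b rho^k. *)
Lemma p4_coordinates :
  exists2 c : G -> p4, cancel c elt_p4 & cancel elt_p4 c.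
Proof.
pose X : p4 := ((1, 0), 0)%R; pose Y : p4 := ((0, 1), 0)%R.
pose R : p4 := (0, 1)%R.
have relH : p4_relations X Y R.
  by split; apply/eqP.
have [c [[c_morph cx cy cr] _]] := hG.2 _ _ _ _ relH.
(* Both the identity and [elt_p4 \o c] are endomorphisms of G fixing the three generators, so both
   equal [u]. *)
have [u [_ uniq]] := hG.2 _ _ _ _ hG.1.
pose cM : UMagmaMorphism.type G p4 := HB.pack c (isUMagmaMorphism.Build _ _ c c_morph).
have cK : cancel c elt_p4.
  suff e : elt_p4 \o c = id by move=> g; rewrite -[RHS]/(id g) -e.
  have uid : u = id by apply: uniq; split.
  rewrite -uid; symmetry; apply: uniq; split => /=.
  - split => [|g h] /=; first by rewrite c_morph.1 elt_p4_morphism.1.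
    by rewrite c_morph.2 elt_p4_morphism.2.
  - by rewrite cx -[RHS]elt_x.
  - by rewrite cy -[RHS]elt_y.
  - by rewrite cr -[RHS]elt_rho.
exists c => //.
have cz g n : c (zexpg g n) = zexpg (c g) n.
  by case: n => n /=; rewrite -[c _]/(cM _) ?gmulfXn // gmulfV gmulfXn.
move=> [p k]; rewrite -[c _]/(cM _) !gmulfM gmulfXn /cM /= !cz cx cy cr !zexpg_p4.
case: p => a b; move: k.
by apply: Z4_ind; rewrite /= /mul /= /p4_mul /=; congr (_, _); gauss.
Qed.

Lemma elt_inj p k q l : elt p k = elt q l -> p = q /\ k = l.
Proof.
have [c _ /can_inj inj] := p4_coordinates.
by move=> e; case: (inj (p, k) (q, l) e).
Qed.

Lemma elt_surj g : exists p k, g = elt p k.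
Proof.
by have [c cK _] := p4_coordinates; exists (c g).1, (c g).2; rewrite -[LHS]cK.
Qed.

Lemma elt1 : elt 0%R 0%R = 1.
Proof. by rewrite /elt /lattice !mul1g. Qed.

Lemma eltV p k : (elt p k)^-1 = elt (- twist (- k)%R p)%R (- k)%R.
Proof.
by apply: mulg1_eq; rewrite eltM twistN -twistM !GRing.subrr -elt1.
Qed.

Lemma eltJ p k q l :
  elt p k ^ elt q l = elt (twist (- l)%R (p - q + twist k q)%R) k.
Proof.
rewrite conjgE eltV !eltM; congr (elt _ _); last first.
  by rewrite GRing.addrCA GRing.addNr GRing.addr0.
by rewrite -twistN -twistD -GRing.addrA [RHS]twistD !twistD; gauss.
Qed.

(** Up to a unit, conjugation shifts p by a multiple of 1 - (-i)^k. Hence classes are unit orbits in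
    A, unit orbits modulo 2 in the coset A rho^2, and unit orbits modulo 1 + i in the two odd
    cosets. All parity arguments below rest on this. *)
Lemma conjugate_eltP p k q l :
  conjugate (elt p k) (elt q l) <->
  l = k /\ exists s m, q = twist m (p - s + twist k s)%R.
Proof.
split=> [[h]|[-> [s [m ->]]]].
  have [s [m ->]] := elt_surj h; rewrite eltJ => /elt_inj [-> ->].
  by split=> //; exists s, (- m)%R.
by exists (elt s (- m)%R); rewrite eltJ GRing.opprK.
Qed.

Lemma rho2E : rho ^+ 2 = elt 0%R 2%R.
Proof. by rewrite expg2 -elt_rho eltM; congr (elt _ _); apply: val_inj. Qed.

Lemma latticeP g :
  subgroup_generated [set x; y] g <-> exists p, g = elt p 0%R.
Proof.
split=> [Ag|[p ->] H /= [Hgp Hxy]].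
- apply: (Ag [set g | exists p, g = elt p 0%R]); split=> /=.
  + split; first by apply/mem_set; exists 0%R; rewrite elt1.
    move=> _ _ /set_mem[p ->] /set_mem[q ->]; apply/mem_set.
    by exists (p - q)%R; rewrite eltV eltM GRing.oppr0 GRing.addr0.
  + by move=> _ [->|->]; [exists (1, 0)%R; rewrite elt_x|exists (0, 1)%R; rewrite elt_y].
- have Hx : H x by apply: Hxy; left.
  have Hy : H y by apply: Hxy; right.
  rewrite /elt /lattice mulg1; apply/set_mem; apply: (group_closedM Hgp).
    by apply/mem_set; apply: zexpg_closed.
  by apply/mem_set; apply: zexpg_closed.
Qed.

Lemma lattice_rho2P g :
  right_coset (subgroup_generated [set x; y]) (rho ^+ 2) g <->
  exists p, g = elt p 2%R.
Proof.
split=> [[h /latticeP[p ->] <-]|[p ->]].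
  by exists p; rewrite rho2E eltM GRing.add0r GRing.addr0.
exists (elt p 0%R); first by apply/latticeP; exists p.
by rewrite rho2E eltM GRing.add0r GRing.addr0.
Qed.

Lemma tau_elt h p k :
  tau (subgroup_generated [set x; y]) rho h (elt p k) =
  if k == 2%R then elt p k ^ h else elt p k.
Proof.
rewrite /tau; case: eqP => [->|k2].
  by rewrite mem_set //; apply/lattice_rho2P; exists p.
by rewrite memNset // => /lattice_rho2P[q /elt_inj[_ /k2]].
Qed.

Lemma mu_elt p k :
  mu (subgroup_generated [set x; y]) rho (elt p k) =
  if (k == 0%R) || (k == 2%R) then elt p k else elt p k ^ rho.
Proof.
rewrite /mu; case: orP => [k02|k02].
  rewrite mem_set //; case: k02 => /eqP->; [left|right].
    by apply/latticeP; exists p.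
  by apply/lattice_rho2P; exists p.
rewrite memNset // => -[] => [/latticeP|/lattice_rho2P] [q /elt_inj[_ kE]];
  by apply: k02; rewrite kE; auto.
Qed.

End Coordinates.

(** * Groups generated by bijections *)

Section Generation.
Variable T : Type.
Implicit Types (S K : set (T -> T)) (f g : T -> T).

(** The ambient group [K] supplies bijectivity: it guarantees that the intersection defining the
    generated set is over a nonempty family. *)
Lemma bijections_generated_group S K :
  bijection_group K -> S `<=` K -> bijection_group (bijections_generated S).
Proof.
move=> Kgp SK; split.
- by move=> f Sf; have [/(_ f) + _ _ _] := Kgp; apply; apply: Sf.
- by move=> H /= [[_ H1 _ _] _].
- by move=> f g Sf Sg H /= HS; have [[_ _ + _] _] := HS; apply; [apply: Sf|apply: Sg].
- by move=> f g Sf fK gK H /= HS; have [[_ _ _ +] _] := HS; apply; [apply: Sf| |].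
Qed.

(** Undoes a normalization: f lies in the group once its composite with a group element does. *)
Lemma bijection_group_cancel K f g :
  bijection_group K -> K g -> K (g \o f) -> K f.
Proof.
move=> [Kbij _ KM KV] Kg Kgf; have [h gK hK] := Kbij g Kg.
suff -> : f = h \o (g \o f) by apply: KM => //; apply: KV gK hK.
by apply/funext => t /=; rewrite gK.
Qed.

End Generation.

(** * Weak Cayley table maps of an arbitrary group *)

Section WeakCayley.
Variable G : groupType.
Implicit Types (f g h u : G) (F E : G -> G).

Lemma conjugate_refl g : conjugate g g.
Proof. by exists 1; rewrite conjg1. Qed.

Lemma conjugateJ g u : conjugate g (g ^ u).
Proof. by exists u. Qed.

Lemma conjugate_sym g h : conjugate g h -> conjugate h g.
Proof. by move=> [u ->]; exists u^-1; rewrite conjgK. Qed.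

Lemma conjugate_trans g h u : conjugate g h -> conjugate h u -> conjugate g u.
Proof. by move=> [a ->] [b ->]; exists (a * b); rewrite conjgM. Qed.

Lemma conjugate_mulC g h : conjugate (g * h) (h * g).
Proof. by exists g; rewrite conjgE !mulgA mulVg mul1g. Qed.

Lemma conjugate1 g : conjugate 1 g -> g = 1.
Proof. by move=> [u ->]; rewrite conj1g. Qed.

Notation W := (weak_cayley_table_group G).

(** Conjugate elements have the form ab and ba, and F(a)F(b) is conjugate to F(b)F(a). *)
Lemma wct_conjugate F g h : W F -> conjugate g h -> conjugate (F g) (F h).
Proof.
move=> [_ FM] [u ->]; rewrite conjgE.
apply: conjugate_sym; apply: conjugate_trans (FM _ _) _.
apply: conjugate_trans (conjugate_mulC _ _) _.
apply: conjugate_trans (conjugate_sym (FM _ _)) _.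
by rewrite -mulgA mulgV mulg1; apply: conjugate_refl.
Qed.

Lemma wct_comp F E : W F -> W E -> W (E \o F).
Proof.
move=> WF WE; split=> [|g h /=]; first exact: bij_comp WE.1 WF.1.
exact: conjugate_trans (wct_conjugate WE (WF.2 g h)) (WE.2 _ _).
Qed.

(** If e is the preimage of 1, then F(ee) is conjugate to 1, so ee = e by injectivity and e = 1. *)
Lemma wct1 F : W F -> F 1 = 1.
Proof.
move=> [Fbij FM]; have [E FK EK] := Fbij.
have F1 g : conjugate 1 (F g) -> g = E 1 by move=> /conjugate1 <-; rewrite FK.
have EE : E 1 * E 1 = E 1.
  apply/F1; apply: conjugate_sym; apply: conjugate_trans (FM _ _) _.
  by rewrite EK mulg1; apply: conjugate_refl.
by rewrite -[1 in LHS](_ : E 1 = 1) ?EK //; apply: (mulIg (E 1)); rewrite EE mul1g.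
Qed.

Lemma wctM1 F g h : W F -> g * h = 1 -> F g * F h = 1.
Proof.
by move=> WF gh; apply/conjugate1; rewrite -(wct1 WF) -gh; apply: WF.2.
Qed.

Lemma wctV F g : W F -> F g^-1 = (F g)^-1.
Proof. by move=> WF; apply/esym/mulg1_eq/wctM1 => //; rewrite mulgV. Qed.

(* The definition of the weak Cayley table group only makes it a submonoid at
   first sight; reflecting conjugacy makes closure under inverses evident. *)
Definition conjugacy_faithful_wct : set (G -> G) :=
  [set F | W F /\ forall g h, conjugate (F g) (F h) -> conjugate g h].

Lemma conjugacy_faithful_wct_group : bijection_group conjugacy_faithful_wct.
Proof.
split.
- by move=> F [[]].
- split=> //; split; first by exists id.
  by move=> g h; apply: conjugate_refl.
- move=> F E [WF FJ] [WE EJ]; split; first exact: wct_comp.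
  by move=> g h /= /FJ/EJ.
- move=> F E [WF FJ] FK EK; split=> [|g h gh]; last first.
    by rewrite -(EK g) -(EK h); apply: wct_conjugate.
  split=> [|g h]; first exact: Bijective EK FK.
  apply: FJ; rewrite EK; apply: conjugate_sym; apply: conjugate_trans (WF.2 _ _) _.
  by rewrite !EK; apply: conjugate_refl.
Qed.

(** When F moves every element within its class, F(gh) may be replaced by gh in the defining
    condition, and reflection of conjugacy is automatic. *)
Lemma class_preserving_faithful_wct F :
  bijective F -> (forall g, conjugate g (F g)) ->
  (forall g h, conjugate (g * h) (F g * F h)) -> conjugacy_faithful_wct F.
Proof.
move=> Fbij Fg FM; split=> [|g h Fgh]; first split=> // g h.
  exact: conjugate_trans (conjugate_sym (Fg _)) (FM _ _).
exact: conjugate_trans (Fg _) (conjugate_trans Fgh (conjugate_sym (Fg _))).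
Qed.

Lemma automorphism_faithful_wct F :
  automorphisms G F -> conjugacy_faithful_wct F.
Proof.
move=> [Fbij FM]; have [E FK EK] := Fbij.
have F1 : F 1 = 1 by apply: (mulgI (F 1)); rewrite -FM !mulg1.
have FV g : F g^-1 = (F g)^-1 by apply/esym/mulg1_eq; rewrite -FM mulgV F1.
have FJ g u : F (g ^ u) = F g ^ F u by rewrite !conjgE !FM FV.
split; first by split=> // g h; rewrite FM; apply: conjugate_refl.
move=> g h [u]; rewrite -(EK u) -FJ => /(can_inj FK) ->.
exact: conjugateJ.
Qed.

Lemma invg_faithful_wct : conjugacy_faithful_wct (fun g => g^-1).
Proof.
split; first split; first exact: (Bijective (@invgK G) (@invgK G)).
  by move=> g h; rewrite invgM; apply: conjugate_mulC.
by move=> g h [u]; rewrite conjVg => /invg_inj ->; apply: conjugateJ.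
Qed.

Lemma trivial_wct_faithful :
  trivial_weak_cayley_table_group G `<=` conjugacy_faithful_wct.
Proof.
move=> F FG; apply: FG; split; first exact: conjugacy_faithful_wct_group.
by move=> E [/automorphism_faithful_wct|->]; last exact: invg_faithful_wct.
Qed.

End WeakCayley.

(** * The maps [tau] and [mu] as weak Cayley table maps *)

Section Generators.
Variables (G : groupType) (x y rho : G).
Hypothesis hG : p4_presentation x y rho.

Notation el := (elt x y rho).
Notation A := (subgroup_generated [set x; y]).

(** The product lies outside A, where translations by 2Z[i] stay inside a conjugacy class. *)
Lemma conjugate_translate_rho2 p d q k : k <> 2%R ->
  conjugate (el p 2%R * el q k) (el (p + (d + d))%R 2%R * el q k).
Proof.
move=> k2; rewrite !(eltM hG); apply/(conjugate_eltP hG); split=> //.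
(* The witness s solves [- s + twist (2 + k) s = d + d]. *)
case: d => a b; exists (match val k with
  | 0 => (- a, - b) | 1 => (b - a, - a - b) | _ => (- a - b, a - b) end)%R, 0%R.
by move: k k2; apply: Z4_ind => // _; gauss.
Qed.

(** Replacing q by iq changes the product by a multiple of 1 + i, which conjugation absorbs because
    the product lies in an odd coset. *)
Lemma conjugate_rotate_odd p k q l :
  k = 0%R \/ k = 2%R -> l = 1%R \/ l = 3%R ->
  conjugate (el p k * el q l) (el p k * el q l ^ rho).
Proof.
rewrite -[X in _ ^ X](elt_rho x y rho) (eltJ hG) !(eltM hG) => kE lE.
apply/(conjugate_eltP hG); split=> //.
(* This s solves [- s + twist (k + l) s = twist (k + 3) q - twist k q]. *)
exists (if k + l == 1%R then twist (k + 1) q else twist k q)%R, 0%R.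
by case: kE lE => -> [] ->; gauss.
Qed.

(** Treats x, y (m = 0) and rho^2 (m = 2) together: conjugation by [el s m] moves each point of A
    rho^2 by an element of 2Z[i]. A product of two elements of A rho^2 is conjugated as a whole. *)
Lemma tau_faithful_wct s m : m = 0%R \/ m = 2%R ->
  conjugacy_faithful_wct (tau A rho (el s m)).
Proof.
move=> mE; set t := tau _ _ _.
have tE p k : t (el p k) = if k == 2%R then el p k ^ el s m else el p k.
  exact: tau_elt.
have t2 p : exists d, t (el p 2%R) = el (p + (d + d))%R 2%R.
  rewrite tE eqxx (eltJ hG); case: mE => ->; [exists (- s)%R | exists (s - p)%R];
  by congr (elt _ _ _ _ _); gauss.
apply: class_preserving_faithful_wct.
- exists (tau A rho (el s m)^-1) => g; have [p [k ->]] := elt_surj hG g.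
    rewrite tE; case: ifP => k2; last by rewrite (tau_elt hG) k2.
    by rewrite (eltJ hG) (tau_elt hG) k2 -(eltJ hG) conjgK.
  rewrite (tau_elt hG); case: ifP => k2; last by rewrite tE k2.
  by rewrite (eltV hG) (eltJ hG) tE k2 -(eltJ hG) -(eltV hG) conjgKV.
- move=> g; have [p [k ->]] := elt_surj hG g; rewrite tE.
  by case: ifP => _; [apply: conjugateJ|apply: conjugate_refl].
- have t2l p q k : k <> 2%R ->
    conjugate (el p 2%R * el q k) (t (el p 2%R) * t (el q k)).
    move=> k2; have [d ->] := t2 p; rewrite tE; move/eqP/negPf: (k2) => ->.
    exact: conjugate_translate_rho2.
  move=> g h; have [p [k ->]] := elt_surj hG g; have [q [l ->]] := elt_surj hG h.
  have [k2|k2] := eqVneq k 2%R; have [l2|l2] := eqVneq l 2%R.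
  + by rewrite k2 l2 !tE eqxx -conjMg; apply: conjugateJ.
  + by rewrite k2; apply/t2l/eqP.
  + rewrite l2; apply: conjugate_trans (conjugate_mulC _ _) _.
    apply: conjugate_trans (conjugate_mulC _ _); exact/t2l/eqP.
  + by rewrite !tE (negPf k2) (negPf l2); apply: conjugate_refl.
Qed.

Lemma Z4_parity (k : 'Z_4) : (k = 0 \/ k = 2)%R \/ (k = 1 \/ k = 3)%R.
Proof. by move: k; apply: Z4_ind; auto. Qed.

Lemma mu_even p k : k = 0%R \/ k = 2%R -> mu A rho (el p k) = el p k.
Proof. by rewrite (mu_elt hG) => -[->|->]. Qed.

Lemma mu_oddJ p k : k = 1%R \/ k = 3%R -> mu A rho (el p k) = el p k ^ rho.
Proof. by rewrite (mu_elt hG) => -[->|->]. Qed.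

Lemma mu_odd p k :
  k = 1%R \/ k = 3%R -> mu A rho (el p k) = el (twist 3%R p) k.
Proof.
move=> k13; rewrite mu_oddJ // -[X in _ ^ X](elt_rho x y rho) (eltJ hG).
by congr (elt _ _ _ _ _); case: k13 => ->; gauss.
Qed.

(** The map has order dividing 4, hence is bijective. Only products of mixed parity need an
    argument, since two odd factors are conjugated by the same element. *)
Lemma mu_faithful_wct : conjugacy_faithful_wct (mu A rho).
Proof.
apply: class_preserving_faithful_wct.
- have mu4 g : iter 4 (mu A rho) g = g.
    have [p [k ->]] := elt_surj hG g; have [k02|k13] := Z4_parity k.
      by rewrite /= !mu_even.
    by rewrite /= !mu_odd // -!twistM !Z4E.
  by exists (iter 3 (mu A rho)) => g; rewrite -[RHS]mu4.
- move=> g; have [p [k ->]] := elt_surj hG g; have [k02|k13] := Z4_parity k.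
    by rewrite mu_even //; apply: conjugate_refl.
  by rewrite mu_oddJ //; apply: conjugateJ.
- move=> g h; have [p [k ->]] := elt_surj hG g; have [q [l ->]] := elt_surj hG h.
  have [k02|k13] := Z4_parity k; have [l02|l13] := Z4_parity l.
  + by rewrite !mu_even //; apply: conjugate_refl.
  + by rewrite mu_even // mu_oddJ //; apply: conjugate_rotate_odd.
  + rewrite mu_oddJ // mu_even //; apply: conjugate_trans (conjugate_mulC _ _) _.
    by apply: conjugate_trans (conjugate_mulC _ _); apply: conjugate_rotate_odd.
  + by rewrite !mu_oddJ // -conjMg; apply: conjugateJ.
Qed.

End Generators.

(** * Norms and unit isometries on Z[i] *)

Section GaussianIntegers.
Implicit Types (p q v w : int * int).

Lemma gauss_ind (S : int * int -> Prop) :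
  (forall p q, S p -> S q -> S (p + q)%R) -> (forall p, S p -> S (- p)%R) ->
  S (1, 0)%R -> S (0, 1)%R -> forall p, S p.
Proof.
move=> SD SN S1 Si.
have S0 : S (0, 0)%R by have := SD _ _ S1 (SN _ S1); rewrite GRing.addrN.
have Smul p : S p -> forall n : int, S (n * p.1, n * p.2)%R.
  move=> Sp; elim/int_rect=> [|n IH|n IH]; first by rewrite !GRing.mul0r.
    by have -> : (Posz n.+1 * p.1, Posz n.+1 * p.2)%R =
      ((Posz n * p.1, Posz n * p.2) + p)%R; [gauss|apply: SD].
  have -> : (- Posz n.+1 * p.1, - Posz n.+1 * p.2)%R =
    ((- Posz n * p.1, - Posz n * p.2) - p)%R by gauss.
  by apply: SD IH _; apply: SN.
move=> [a b]; have := SD _ _ (Smul _ S1 a) (Smul _ Si b).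
by congr S; gauss.
Qed.

Lemma int_half (n : int) : exists e, (n = e + e \/ n = e + e + 1)%R.
Proof.
elim/int_rect: n => [|n [e [eE|eE]]|n [e [eE|eE]]]; first by exists 0%R; left.
- by exists e; right; lia.
- by exists (e + 1)%R; left; lia.
- by exists (e - 1)%R; right; lia.
- by exists e; left; lia.
Qed.

Definition sqnorm p : int := (p.1 * p.1 + p.2 * p.2)%R.

Lemma sqnorm_twist k p : sqnorm (twist k p) = sqnorm p.
Proof. by move: k; apply: Z4_ind; rewrite /sqnorm twistE /=; lia. Qed.

Lemma sqnorm1 p : sqnorm p = 1%R -> exists k, p = twist k (1, 0)%R.
Proof.
case: p => a b; rewrite /sqnorm /= => ab.
have [[-> bE]|[-> aE]] : (a = 0 /\ (b = 1 \/ b = -1) \/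
    b = 0 /\ (a = 1 \/ a = -1))%R by nia.
  by case: bE => ->; [exists 3%R|exists 1%R].
by case: aE => ->; [exists 0%R|exists 2%R].
Qed.

(* In an isometry fixing 0 the coordinates of the image of p are determined by
   its distances to the images of 1 and i. *)
Lemma sqnorm_re p q :
  sqnorm p = sqnorm q -> sqnorm (p - (1, 0))%R = sqnorm (q - (1, 0))%R -> p.1 = q.1.
Proof. by rewrite /sqnorm /=; lia. Qed.

Lemma sqnorm_im p q :
  sqnorm p = sqnorm q -> sqnorm (p - (0, 1))%R = sqnorm (q - (0, 1))%R -> p.2 = q.2.
Proof. by rewrite /sqnorm /=; lia. Qed.

(** Taking norms gives |f(p+q)| = |f(p)+f(q)| and, by oddness, |f(p-q)| = |f(p)-f(q)|. This fixes
    both axes by induction, and then n + mi through its norm and its distances to n and mi. *)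
Lemma additive_up_to_units_id (f : int * int -> int * int) :
  (forall p q, exists k, f (p + q)%R = twist k (f p + f q)%R) ->
  (forall p, f (- p)%R = (- f p)%R) ->
  f (1, 0)%R = (1, 0)%R -> f (0, 1)%R = (0, 1)%R -> forall p, f p = p.
Proof.
move=> fD fN f1 fi.
have nD p q : sqnorm (f (p + q)%R) = sqnorm (f p + f q)%R.
  by have [k ->] := fD p q; rewrite sqnorm_twist.
have nB p q : sqnorm (f p - f q)%R = sqnorm (f (p - q)%R) by rewrite nD fN.
have f0 : f (0, 0)%R = (0, 0)%R.
  have : f (0, 0)%R = (- f (0, 0))%R := fN (0, 0)%R.
  case: (f _) => a b; rewrite oppE /= => -[ha hb]; congr (_, _); lia.
(* The value f(n+1) has norm (n+1)^2 and lies at distance n from 1; these two circles are tangent at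
   n+1. *)
have natRe (n : nat) : f (Posz n, 0%R) = (Posz n, 0%R).
  elim: n => [//|n IH].
  have e : ((Posz n, 0) + (1, 0) = (Posz n.+1, 0) :> (int * int))%R by gauss.
  have := nD (Posz n, 0)%R (1, 0)%R; have := nB (Posz n.+1, 0)%R (1, 0)%R.
  rewrite e IH f1 -e GRing.addrK IH e; case: (f _) => a b; rewrite /sqnorm /= => h1 h2.
  have -> : a = Posz n.+1 by lia.
  by congr (_, _); nia.
have natIm (n : nat) : f (0%R, Posz n) = (0%R, Posz n).
  elim: n => [//|n IH].
  have e : ((0, Posz n) + (0, 1) = (0, Posz n.+1) :> (int * int))%R by gauss.
  have := nD (0, Posz n)%R (0, 1)%R; have := nB (0, Posz n.+1)%R (0, 1)%R.
  rewrite e IH fi -e GRing.addrK IH e; case: (f _) => a b; rewrite /sqnorm /= => h1 h2.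
  have -> : b = Posz n.+1 by lia.
  by congr (_, _); nia.
have fRe (n : int) : f (n, 0)%R = (n, 0)%R.
  case: n => n; first exact: natRe.
  have -> : (Negz n, 0)%R = (- (Posz n.+1, 0) :> (int * int))%R by gauss.
  by rewrite fN natRe.
have fIm (n : int) : f (0, n)%R = (0, n)%R.
  case: n => n; first exact: natIm.
  have -> : (0, Negz n)%R = (- (0, Posz n.+1) :> (int * int))%R by gauss.
  by rewrite fN natIm.
move=> [n m]; have e : ((n, 0) + (0, m) = (n, m) :> (int * int))%R by gauss.
have := nD (n, 0)%R (0, m)%R.
have := nB (n, m)%R (n, 0)%R; have := nB (n, m)%R (0, m)%R.
rewrite -{2}e GRing.addrK -{3}e (GRing.addrC (n, 0)%R) GRing.addrK -e.
rewrite (GRing.addrC (n, 0)%R) !fRe !fIm (GRing.addrC (0, m)%R) e.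
have := fRe n; have := fIm m.
have [-> // | n0] := eqVneq n 0%R; have [-> // | m0] := eqVneq m 0%R.
move=> _ _; case: (f _) => a b; rewrite /sqnorm /= => h1 h2 h3.
have : (n * (a - n) = 0)%R by lia.
have : (m * (b - m) = 0)%R by lia.
by move=> hb ha; congr (_, _); nia.
Qed.

(** After normalization f is an isometry fixing 0 and 1, so it is the identity or complex
    conjugation. *)
Lemma unit_isometry_affine (f : int * int -> int * int) :
  (forall p q, exists k, (f p - f q)%R = twist k (p - q)%R) ->
  exists t m, forall p, f p = (t + twist m p)%R.
Proof.
move=> fB; have [m f1] := fB (1, 0)%R (0, 0)%R.
pose g p := twist (- m)%R (f p - f (0, 0))%R.
have gB p q : exists k, (g p - g q)%R = twist k (p - q)%R.
  have [k fk] := fB p q; exists (- m + k)%R.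
  by rewrite twistM -fk /g -twistN -twistD GRing.opprB GRing.addrA GRing.addrNK.
have gn p q : sqnorm (g p - g q)%R = sqnorm (p - q)%R.
  by have [k ->] := gB p q; rewrite sqnorm_twist.
have g0 : g (0, 0)%R = (0, 0)%R by rewrite /g GRing.subrr; move: (- m)%R; apply: Z4_ind.
have g1 : g (1, 0)%R = (1, 0)%R by rewrite /g f1 -twistM GRing.addNr.
have gn0 p : sqnorm (g p) = sqnorm p.
  by have := gn p (0, 0)%R; rewrite g0 !GRing.subr0.
have gre p : (g p).1 = p.1.
  by apply: sqnorm_re => //; rewrite -{1}g1 gn.
have gid p : g p = p.
  rewrite [LHS]surjective_pairing [RHS]surjective_pairing gre; congr (_, _).
  have [gi|gi] : g (0, 1)%R = (0, 1)%R \/ g (0, 1)%R = (0, -1)%R.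
    have := gn0 (0, 1)%R; have := gre (0, 1)%R.
    case: (g _) => a b; rewrite /sqnorm /= => ->.
    by move=> h; have [->|->] : (b = 1 \/ b = -1)%R; [nia|left|right].
    by apply: sqnorm_im => //; rewrite -{1}gi gn.
  have gim q : (g q).2 = (- q.2)%R.
    have := gn q (0, 1)%R; have := gn0 q; rewrite gi /sqnorm /= gre; lia.
  (* Conjugation is excluded because 2 - i is not a unit multiple of 2 + i. *)
  have [k] := gB (2, 1)%R (0, 0)%R; rewrite g0 [g _]surjective_pairing gre gim.
  by move: k; apply: Z4_ind.
exists (f (0, 0)%R), m => p.
by rewrite -{2}(gid p) /g -twistM GRing.addrN twist0 GRing.addrC GRing.subrK.
Qed.

End GaussianIntegers.

(** * Elements of the generated group *)

Section Classification.
Variables (G : groupType) (x y rho : G).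
Hypothesis hG : p4_presentation x y rho.

Notation el := (elt x y rho).
Notation A := (subgroup_generated [set x; y]).
Notation W := (weak_cayley_table_group G).
Notation generators := (trivial_weak_cayley_table_group G `|`
  [set tau A rho x; tau A rho y; tau A rho (rho ^+ 2); mu A rho]).
Notation K := (bijections_generated generators).
Implicit Types (F E : G -> G).

Lemma generators_faithful_wct : generators `<=` @conjugacy_faithful_wct G.
Proof.
move=> F [/trivial_wct_faithful // |].
have tx := tau_faithful_wct hG (1, 0)%R (or_introl erefl).
have ty := tau_faithful_wct hG (0, 1)%R (or_introl erefl).
have tr := tau_faithful_wct hG 0%R (or_intror erefl).
rewrite elt_x in tx; rewrite elt_y in ty; rewrite -(rho2E hG) in tr.
by move=> [[[->|->]|->]|->] //; apply: mu_faithful_wct.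
Qed.

Lemma generated_group : bijection_group K.
Proof.
apply: bijections_generated_group generators_faithful_wct.
exact: conjugacy_faithful_wct_group.
Qed.

Lemma generated_wct F : K F -> W F.
Proof.
move=> KF; suff [] : conjugacy_faithful_wct F by [].
apply: KF; split; first exact: conjugacy_faithful_wct_group.
exact: generators_faithful_wct.
Qed.

Lemma generated_comp F E : K F -> K E -> K (F \o E).
Proof. by have [_ _ KM _] := generated_group; apply: KM. Qed.

Lemma generated_trivial F : trivial_weak_cayley_table_group G F -> K F.
Proof. by move=> TF; apply: sub_gen_smallest; left. Qed.

Lemma generated_automorphism F : automorphisms G F -> K F.
Proof. by move=> AF; apply: generated_trivial; apply: sub_gen_smallest; left. Qed.

Lemma generated_invg : K (fun g => g^-1).
Proof. by apply: generated_trivial; apply: sub_gen_smallest; right. Qed.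

Lemma generated_conjg u : K (fun g => g ^ u).
Proof.
apply: generated_automorphism; split=> [|g h]; last exact: conjMg.
by exists (fun g => g ^ u^-1) => g; rewrite ?conjgK ?conjgKV.
Qed.

Lemma generated_mu : K (mu A rho).
Proof. by apply: sub_gen_smallest; right; right. Qed.

Lemma generated_tau_rho2 : K (tau A rho (el 0%R 2%R)).
Proof. by rewrite -(rho2E hG); apply: sub_gen_smallest; right; left; right. Qed.

Lemma tau_latticeE s p k : tau A rho (el s 0%R) (el p k) =
  if k == 2%R then el (p - (s + s))%R 2%R else el p k.
Proof.
rewrite (tau_elt hG); case: eqP => // ->; rewrite (eltJ hG).
by congr (elt _ _ _ _ _); gauss.
Qed.

Lemma tau_rho2E p k : tau A rho (el 0%R 2%R) (el p k) =
  if k == 2%R then el (- p)%R 2%R else el p k.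
Proof.
rewrite (tau_elt hG); case: eqP => // ->; rewrite (eltJ hG).
by congr (elt _ _ _ _ _); gauss.
Qed.

(** On A rho^2 this is translation by -2s, so composition is additive in s and the generators 1 and
    i of Z[i] suffice. *)
Lemma generated_tau_lattice s : K (tau A rho (el s 0%R)).
Proof.
have [_ _ _ KV] := generated_group.
have tauD p q : tau A rho (el (p + q)%R 0%R) =
    tau A rho (el p 0%R) \o tau A rho (el q 0%R).
  apply/funext => g /=; have [r [k ->]] := elt_surj hG g; rewrite !tau_latticeE.
  case: ifP => k2; rewrite tau_latticeE ?k2 // eqxx.
  by congr (elt _ _ _ _ _); gauss.
have tau0 : tau A rho (el 0%R 0%R) = id.
  apply/funext => g /=; have [r [k ->]] := elt_surj hG g; rewrite !tau_latticeE.
  by case: eqP => // ->; congr (elt _ _ _ _ _); case: r => a b; gauss.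
move: s; apply: gauss_ind => [p q Kp Kq|p Kp||].
- by rewrite tauD; apply: generated_comp.
- apply: (KV _ _ Kp) => g; rewrite -[LHS]/((_ \o _) g) -tauD.
    by rewrite GRing.addNr tau0.
  by rewrite GRing.addrN tau0.
- by rewrite elt_x; apply: sub_gen_smallest; right; left; left; left.
- by rewrite elt_y; apply: sub_gen_smallest; right; left; left; right.
Qed.

Lemma p4_automorphism (t s : p4 -> p4) :
  cancel t s -> cancel s t -> {morph t : g h / g * h} ->
  exists2 E, K E & forall p k, E (el p k) = el (t (p, k)).1 (t (p, k)).2.
Proof.
move=> ts st tM; have [c cK eK] := p4_coordinates hG.
exists (elt_p4 x y rho \o t \o c) => [|p k]; last first.
  by rewrite /= -[el p k]/(elt_p4 x y rho (p, k)) eK.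
apply: generated_automorphism; split.
  exists (elt_p4 x y rho \o s \o c) => g /=; first by rewrite eK ts cK.
  by rewrite eK st cK.
have elM g h : elt_p4 x y rho (g * h) = elt_p4 x y rho g * elt_p4 x y rho h.
  by rewrite [RHS](eltM hG).
have cM g h : c (g * h) = c g * c h by rewrite -{1}(cK g) -{1}(cK h) -elM eK.
by move=> g h /=; rewrite cM tM elM.
Qed.

(** Complex conjugation on A extends to an automorphism inverting rho. *)
Lemma generated_reflection :
  exists2 E, K E & forall p k, E (el p k) = el (p.1, - p.2)%R (- k)%R.
Proof.
pose t (g : p4) : p4 := ((g.1.1, - g.1.2), - g.2)%R.
have tK : cancel t t by move=> [[a b] k]; rewrite /t /= !GRing.opprK.
have [] := p4_automorphism tK tK; last by move=> E KE EE; exists E.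
move=> [p k] [q l]; rewrite /t /mul /= /p4_mul /=; congr (_, _); last first.
  by rewrite GRing.opprD.
by move: k; apply: Z4_ind; gauss.
Qed.

(** This comes from the automorphism fixing A pointwise and sending rho to w rho; it serves to
    remove a translation on A rho^2. *)
Lemma generated_shear w : exists2 E, K E &
  [/\ forall p, E (el p 0%R) = el p 0%R
    & forall p, E (el p 2%R) = el (p + (w + twist 1 w))%R 2%R].
Proof.
(* The cocycle with (v rho)^k = s(v,k) rho^k; for k = 3 the sum v + [twist 1 v] + [twist 2 v]
   collapses to [- twist 3 v]. *)
pose s (v : int * int) (k : 'Z_4) := (match val k with
  | 0 => 0 | 1 => v | 2 => v + twist 1 v | _ => - twist 3 v end)%R.
pose t v (g : p4) : p4 := (g.1 + s v g.2, g.2)%R.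
have sN v k : s (- v)%R k = (- s v k)%R.
  by rewrite /s; case: (val k) => [|[|[|?]]]; rewrite /= ?twistN //; gauss.
have tN v : cancel (t v) (t (- v)%R).
  by move=> [p k]; rewrite /t /= sN GRing.addrK.
have tN' : cancel (t (- w)%R) (t w) by rewrite -{2}(GRing.opprK w).
have tM : {morph t w : g h / g * h}.
  move=> [p k] [q l]; rewrite /t /mul /= /p4_mul /=; congr (_, _).
  rewrite /s; move: k l; apply: Z4_ind; apply: Z4_ind; rewrite ?Z4E /=; gauss.
have [E KE EE] := p4_automorphism (tN w) tN' tM.
exists E => //; split=> p; rewrite EE //=.
by rewrite GRing.addr0.
Qed.

(** * Action of a weak Cayley table map on the cosets of A *)

Lemma wct_inj F : W F -> injective F.
Proof. by move=> [/bij_inj]. Qed.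

Lemma wct_rho2_coset F p : W F -> exists q, F (el p 2%R) = el q 2%R.
Proof.
move=> WF; have [q [k Fp]] := elt_surj hG (F (el p 2%R)).
have sq : el p 2%R * el p 2%R = 1.
  rewrite (eltM hG) -(elt1 x y rho); case: p {Fp} => a b.
  by congr (elt _ _ _ _ _); gauss.
have := wctM1 WF sq; rewrite Fp (eltM hG) -(elt1 x y rho) => /(elt_inj hG) [q0 k0].
have [kE|kE] : (k = 0 \/ k = 2)%R by move: k k0 {Fp q0}; apply: Z4_ind; auto.
  (* A is torsion-free, so an involution sent into A would share the image of 1. *)
  have q00 : q = (0, 0)%R.
    move: q0; rewrite kE twist0; case: q {Fp} => a b [? ?].
    by congr (_, _); lia.
  have : F (el p 2%R) = F 1 by rewrite Fp kE q00 (wct1 WF) -(elt1 x y rho).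
  by move/(wct_inj WF); rewrite -(elt1 x y rho) => /(elt_inj hG) [].
by exists q; rewrite kE.
Qed.

Lemma wct_lattice F p : W F -> exists q, F (el p 0%R) = el q 0%R.
Proof.
move=> WF; have [q Fq] := wct_rho2_coset p WF.
have [r Fr] := wct_rho2_coset 0%R WF.
have := WF.2 (el p 2%R) (el 0%R 2%R).
have [s [k Fs]] := elt_surj hG (F (el p 2%R * el 0%R 2%R)).
rewrite Fs Fq Fr !(eltM hG) Z4E => /(conjugate_eltP hG) [k0 _].
exists s; rewrite [in RHS]k0 -Fs (eltM hG) Z4E; congr (F (elt _ _ _ _ _)).
by case: p {Fq Fs} => a b; gauss.
Qed.

Lemma conjugate_lattice p q :
  conjugate (el p 0%R) (el q 0%R) -> exists m, q = twist m p.
Proof.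
move=> /(conjugate_eltP hG) [_ [s [m ->]]]; exists m.
by rewrite twist0 GRing.subrK.
Qed.

Lemma wct_odd_coset F p k : W F -> k = 1%R \/ k = 3%R ->
  exists q l, (l = 1 \/ l = 3)%R /\ F (el p k) = el q l.
Proof.
move=> WF k13; have [q [l Fp]] := elt_surj hG (F (el p k)); exists q, l; split=> //.
have kk : (k + k)%R = 2%R by case: k13 => ->; rewrite Z4E.
have := WF.2 (el p k) (el p k).
have [r Fr] := wct_rho2_coset (p + twist k p)%R WF.
rewrite Fp !(eltM hG) kk Fr => /(conjugate_eltP hG) [+ _].
by move: l {Fp}; apply: Z4_ind; auto.
Qed.

Lemma wct_lattice_surj F q : W F -> exists p, F (el p 0%R) = el q 0%R.
Proof.
move=> WF; have [[E FK EK] _] := WF.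
have [p [k Ep]] := elt_surj hG (E (el q 0%R)); exists p.
have Fp : F (el p k) = el q 0%R by rewrite -Ep EK.
have [[kE|kE]|k13] := Z4_parity k.
- by rewrite -Fp kE.
- by have [r] := wct_rho2_coset p WF; rewrite -kE Fp kE => /(elt_inj hG) [_ /eqP].
- have [r [l [lE]]] := wct_odd_coset p WF k13; rewrite Fp => /(elt_inj hG) [_ l0].
  by move: lE; rewrite -l0 => -[/eqP|/eqP].
Qed.

Definition fixes_coset (k : 'Z_4) F := forall p, F (el p k) = el p k.

(** Conjugacy inside A is multiplication by units; the last clause holds because x and y are
    conjugate. *)
Lemma wct_lattice_scalar F (f : int * int -> int * int) :
  W F -> (forall p, F (el p 0%R) = el (f p) 0%R) ->
  [/\ forall p q, exists k, f (p + q)%R = twist k (f p + f q)%R,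
      forall p, f (- p)%R = (- f p)%R &
      exists k, f (0, 1)%R = twist k (f (1, 0)%R)].
Proof.
move=> WF Ff; split.
- move=> p q; apply: conjugate_lattice; apply: conjugate_sym.
  have := WF.2 (el p 0%R) (el q 0%R).
  by rewrite !(eltM hG) twist0 Z4E !Ff (eltM hG) Z4E.
- move=> p; have := wctV (el p 0%R) WF.
  by rewrite !(Ff, eltV hG) !Z4E twist0 => /(elt_inj hG) [].
- apply: conjugate_lattice; rewrite -!Ff; apply: (wct_conjugate WF).
  by apply/(conjugate_eltP hG); split=> //; exists 0%R, 3%R.
Qed.

Lemma wct_lattice_unit F (f : int * int -> int * int) :
  W F -> (forall p, F (el p 0%R) = el (f p) 0%R) ->
  exists k, f (1, 0)%R = twist k (1, 0)%R.
Proof.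
move=> WF Ff; have [fD fN [j fi]] := wct_lattice_scalar WF Ff.
set v := f (1, 0)%R in fi *.
(* Multiplication by v in Z[i]; its image is the ideal (v), which contains all values of f. *)
pose mulv (w : int * int) := (v.1 * w.1 - v.2 * w.2, v.1 * w.2 + v.2 * w.1)%R.
have mulv_twist k w : twist k (mulv w) = mulv (twist k w).
  by rewrite /mulv; move: k; apply: Z4_ind; gauss.
have ideal p : exists w, f p = mulv w.
  move: p; apply: gauss_ind => [p q [w fp] [w' fq]|p [w fp]||].
  - have [k ->] := fD p q; rewrite fp fq; exists (twist k (w + w')%R).
    by rewrite -mulv_twist; congr (twist _ _); rewrite /mulv; gauss.
  - by exists (- w)%R; rewrite fN fp /mulv; gauss.
  - by exists (1, 0)%R; rewrite -/v [LHS]surjective_pairing /mulv; gauss.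
  - exists (twist j (1, 0)%R); rewrite fi -mulv_twist; congr (twist _ _).
    by rewrite [LHS]surjective_pairing /mulv; gauss.
have [p Fp] := wct_lattice_surj (1, 0)%R WF.
move: Fp; rewrite Ff => /(elt_inj hG) [fp _].
have [w] := ideal p; rewrite fp /mulv => -[re im].
apply: sqnorm1.
(* Surjectivity onto A puts 1 in the ideal, say vw = 1, and norms are multiplicative. *)
have /intUnitRing.unitzPl/orP[/eqP //|/eqP vN1] : (sqnorm w * sqnorm v = 1)%R.
  by rewrite /sqnorm; nia.
have : (0 <= sqnorm v)%R by rewrite /sqnorm; nia.
by rewrite vN1.
Qed.

(** * Normalization by generators, coset by coset *)

Lemma fix_lattice F : W F -> exists2 E, K E & fixes_coset 0%R (E \o F).
Proof.
move=> WF.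
have [f Ff] := choice (fun p => wct_lattice p WF).
have [m f1] := wct_lattice_unit WF Ff.
pose C g := g ^ el 0%R m.
have KC : K C by apply: generated_conjg.
have WCF : W (C \o F) by apply: wct_comp => //; apply: generated_wct KC.
pose g p := twist (- m)%R (f p).
have Cg p : (C \o F) (el p 0%R) = el (g p) 0%R.
  rewrite /= Ff /C (eltJ hG) twist0; congr (elt _ _ _ (twist _ _) _).
  by rewrite GRing.subrK.
have g1 : g (1, 0)%R = (1, 0)%R by rewrite /g f1 -twistM GRing.addNr.
have [gD gN [j gi]] := wct_lattice_scalar WCF Cg.
have gne p q : p <> q -> g p <> g q.
  by move=> pq e; apply: pq; have := wct_inj WCF (_ : _ (el p 0%R) = _ (el q 0%R));
     rewrite !Cg e => /(_ erefl) /(elt_inj hG) [].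
(* The image of i is a unit, and injectivity excludes 1 and -1, the images of 1 and -1. A reflection
   then corrects the sign. *)
have [gi1|gi1] : g (0, 1)%R = (0, 1)%R \/ g (0, 1)%R = (0, - 1)%R.
- move: (gne (0, 1)%R (1, 0)%R) (gne (0, 1)%R (- (1, 0))%R); rewrite gN g1 gi g1.
  move: {gi} j; apply: Z4_ind; rewrite twistE /= => h1 h2; auto.
  + by case: h1.
  + by case: h2.
- exists C => // p; rewrite Cg; congr (elt _ _ _ _ _).
  exact: (additive_up_to_units_id gD gN).
- have [S KS SE] := generated_reflection.
  have WSCF : W (S \o (C \o F)) by apply: wct_comp => //; apply: generated_wct KS.
  pose h p := ((g p).1, - (g p).2)%R.
  have Sh p : (S \o (C \o F)) (el p 0%R) = el (h p) 0%R.
    by rewrite /= [C _]Cg SE Z4E.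
  have [hD hN _] := wct_lattice_scalar WSCF Sh.
  exists (S \o C) => [|p]; first exact: generated_comp.
  rewrite [LHS]Sh; congr (elt _ _ _ _ _).
  apply: (additive_up_to_units_id hD hN); first by rewrite /h g1.
  by rewrite /h gi1.
Qed.

Lemma fix_rho2_coset F : W F -> fixes_coset 0%R F ->
  exists2 E, K E & fixes_coset 0%R (E \o F) /\ fixes_coset 2%R (E \o F).
Proof.
move=> WF F0; have [f Ff] := choice (fun p => wct_rho2_coset p WF).
(* The product of p rho^2 and q rho^2 is p - q, which F fixes. *)
have [p q|t [m ft]] := @unit_isometry_affine f.
  apply: conjugate_lattice.
  have := WF.2 (el p 2%R) (el q 2%R); rewrite !Ff !(eltM hG) Z4E F0.
  by rewrite !twist2 -!oppE.
(* If twist m were a quarter turn u, then multiplying by 1 an element whose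
   image is rho^2 translated by 1 would force 1 + u and 2 to agree mod 2. *)
have m02 : (m = 0 \/ m = 2)%R.
  have [//|m13] := Z4_parity m; exfalso.
  have := WF.2 (el (1, 0)%R 0%R) (el (twist (- m) ((1, 0) - t))%R 2%R).
  rewrite F0 !(eltM hG) Z4E !Ff (eltM hG) Z4E !ft twist0 twistD -twistM.
  rewrite GRing.addrN !twist0.
  move=> /(conjugate_eltP hG) [_ [s [l]]].
  by case: m13 => ->; move: l; apply: Z4_ind; gauss; case=> h1 h2; lia.
(* F(rho^2) is conjugate to the square of an element of an odd coset. Such squares have even
   coordinate sum, and conjugacy in A rho^2 preserves this parity. *)
have [e te] : exists e, (t.1 + t.2 = e + e)%R.
  have [c [k [k13 Fc]]] := wct_odd_coset 0%R WF (or_introl erefl).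
  have := WF.2 (el 0%R 1%R) (el 0%R 1%R); rewrite Fc !(eltM hG) Z4E Ff ft.
  move=> /(conjugate_eltP hG) [_ [s [l]]].
  have [e [te|te]] := int_half (t.1 + t.2)%R; first by exists e.
  move=> cE; exfalso; move: l m02 te cE; case: k13 => {Fc} ->; case: t {ft} => t1 t2 /=.
    by apply: Z4_ind => -[->|->] h; gauss; case=> h1 h2; lia.
  by apply: Z4_ind => -[->|->] h; gauss; case=> h1 h2; lia.
(* The parameter w is chosen so that [w + twist 1 w] equals -t. *)
have [B KB [B0 B2]] := generated_shear (e - t.1, - e)%R.
have B2F p : B (F (el p 2%R)) = el (twist m p) 2%R.
  rewrite Ff B2 ft; congr (elt _ _ _ _ _); case: (t) te => t1 t2 /= te.
  by rewrite [RHS]surjective_pairing; gauss.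
case: m02 => mE.
- exists B => //; split=> p /=; first by rewrite F0 B0.
  by rewrite B2F mE.
- exists (tau A rho (el 0%R 2%R) \o B).
    by apply: generated_comp => //; apply: generated_tau_rho2.
  split=> p /=; first by rewrite F0 B0 tau_rho2E.
  rewrite B2F tau_rho2E eqxx mE; congr (elt _ _ _ _ _); case: p => a b; gauss.
Qed.

Lemma fix_rho_coset F :
  W F -> fixes_coset 0%R F -> fixes_coset 2%R F ->
  exists2 E, K E & forall g, E (F g) = g.
Proof.
move=> WF F0 F2.
wlog [q Fq] : F WF F0 F2 / exists q, F (el 0%R 1%R) = el q 1%R.
  move=> IH; have [q [l [lE Fq]]] := wct_odd_coset 0%R WF (or_introl erefl).
  case: lE Fq => -> Fq; first by apply: IH => //; exists q.
  (* Inversion swaps the odd cosets but negates A. Conjugation by rho^2 undoes the negation, and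
     [tau] repairs its effect on A rho^2, so both even cosets stay pointwise fixed. *)
  pose E := tau A rho (el 0%R 2%R) \o ((fun g => g ^ el 0%R 2%R) \o (fun g => g^-1)).
  have EE p k : E (el p k) = tau A rho (el 0%R 2%R) (el (twist (2 - k) (- p)) (- k))%R.
    rewrite /E /= (eltV hG) (eltJ hG); congr (tau _ _ _ (elt _ _ _ _ _)).
    by rewrite twistM !twistN; move: k; apply: Z4_ind; gauss.
  have KE : K E.
    apply: generated_comp => //; first exact: generated_tau_rho2.
    by apply: generated_comp => //; [apply: generated_conjg | apply: generated_invg].
  have [||||B KB BF] := IH (E \o F).
  - by apply: wct_comp => //; apply: generated_wct KE.
  - move=> p; rewrite /= F0 EE tau_rho2E !Z4E /=.
    by congr (elt _ _ _ _ _); case: p => a b; gauss.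
  - move=> p; rewrite /= F2 EE tau_rho2E !Z4E /=.
    by congr (elt _ _ _ _ _); case: p => a b; gauss.
  - by eexists; rewrite /= Fq EE tau_rho2E !Z4E /=.
  - by exists (B \o E); first exact: generated_comp.
(* The product of rho and p rho^3 lies in A, so the two images must lie in inverse cosets. *)
have F3 p : exists r, F (el p 3%R) = el r 3%R.
  have [r [l [lE Fr]]] := wct_odd_coset p WF (or_intror erefl).
  exists r; have := WF.2 (el 0%R 1%R) (el p 3%R).
  rewrite Fq Fr !(eltM hG) Z4E F0 => /(conjugate_eltP hG) [+ _].
  by case: lE => -> //; rewrite Z4E => /eqP.
have F1 p : exists r, F (el p 1%R) = el r 1%R.
  have [r [l [lE Fr]]] := wct_odd_coset p WF (or_introl erefl).
  have [s Fs] := F3 0%R.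
  exists r; have := WF.2 (el p 1%R) (el 0%R 3%R).
  rewrite Fs Fr !(eltM hG) Z4E F0 => /(conjugate_eltP hG) [+ _].
  by case: lE => -> //; rewrite Z4E => /eqP.
have [f Ff] := choice F1.
have [a b|t [m ft]] := @unit_isometry_affine f.
  apply: conjugate_lattice.
  have := WF.2 (el a 1%R) (el b 1%R)^-1.
  rewrite (wctV _ WF) !Ff !(eltV hG) !(eltM hG) !Z4E F0.
  by rewrite !twistN -!twistM !Z4E !twist0.
(* The square of F(rho) = t rho is conjugate to the fixed element rho^2, whose class is 2Z[i] rho^2;
   so [t + twist 1 t] is divisible by 2. *)
have [e te] : exists e, (t.1 + t.2 = e + e)%R.
  have := WF.2 (el 0%R 1%R) (el 0%R 1%R); rewrite Ff !(eltM hG) Z4E F2 ft.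
  move=> /(conjugate_eltP hG) [_ [s [l]]].
  have [e [te|te]] := int_half (t.1 + t.2)%R; first by exists e.
  move=> tE; exfalso; move: l te tE; case: t {ft} => t1 t2 /=.
  by move: m; apply: Z4_ind; apply: Z4_ind => h; gauss; case=> h1 h2; lia.
(* Here [s - twist 1 s] equals t, so conjugation by s removes the translation on A rho. The [tau]
   factor cancels its shift by -2s on A rho^2, and m copies of [mu] remove the unit [twist m]. *)
pose s := (e, t.2 - e)%R.
pose E := iter m (mu A rho) \o
  (tau A rho (el (- s)%R 0%R) \o (fun g => g ^ el s 0%R)).
have KE : K E.
  apply: generated_comp => //.
    elim: (nat_of_ord m) => [|n IH]; first by have [_ ? _ _] := generated_group.
    by apply: (generated_comp _ IH); apply: generated_mu.
  apply: generated_comp => //; first exact: generated_tau_lattice.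
  exact: generated_conjg.
have EE p k : E (el p k) =
    iter m (mu A rho) (tau A rho (el (- s) 0) (el (p - s + twist k s) k))%R.
  by rewrite /E /= (eltJ hG) GRing.oppr0 twist0.
have E_even p k : k = 0%R \/ k = 2%R -> E (el p k) = el p k.
  move=> k02; have -> : E (el p k) = iter m (mu A rho) (el p k).
    rewrite EE tau_latticeE; case: k02 => -> /=; congr (iter _ _ (elt _ _ _ _ _));
    by case: p => a b; gauss.
  by elim: (nat_of_ord m) => [//|n /= ->]; rewrite mu_even.
have E_rho p : E (F (el p 1%R)) = el p 1%R.
  rewrite Ff EE ft tau_latticeE /=.
  have -> : (t + twist m p - s + twist 1 s = twist m p)%R.
    by rewrite /s [RHS]surjective_pairing; gauss.
  move: m {ft EE E_even E KE}; apply: Z4_ind => /=;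
    by rewrite ?(mu_odd hG) -?twistM ?Z4E //; auto.
exists E => // g; have [p [k ->]] := elt_surj hG g.
have WEF : W (E \o F) by apply: wct_comp => //; apply: generated_wct KE.
move: k; apply: Z4_ind; rewrite ?F0 ?F2 ?E_even //; auto.
have -> : el p 3%R = (el (- twist 1 p)%R 1%R)^-1.
  by rewrite (eltV hG) twistN GRing.opprK -twistM !Z4E.
by rewrite -[LHS]/((E \o F) _) (wctV _ WEF) /= E_rho.
Qed.

End Classification.

Theorem corollary6p13 (G : groupType) (x y rho : G)
    (hG : p4_presentation x y rho) :
  let A := subgroup_generated [set x; y] in
  [/\ weak_cayley_table_group G (tau A rho x),
      weak_cayley_table_group G (tau A rho y),
      weak_cayley_table_group G (tau A rho (rho ^+ 2)),
      weak_cayley_table_group G (mu A rho)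
    & weak_cayley_table_group G =
      bijections_generated
        (trivial_weak_cayley_table_group G `|`
         [set tau A rho x; tau A rho y; tau A rho (rho ^+ 2); mu A rho])].
Proof.
move=> A; have gen F := @generators_faithful_wct _ _ _ _ hG F; split.
- by case: (gen _ (or_intror (or_introl (or_introl (or_introl erefl))))).
- by case: (gen _ (or_intror (or_introl (or_introl (or_intror erefl))))).
- by case: (gen _ (or_intror (or_introl (or_intror erefl)))).
- by case: (mu_faithful_wct hG).
apply/seteqP; split=> F; last exact: (generated_wct hG).
move=> WF; have gp := generated_group hG.
have [E0 K0 F0] := fix_lattice hG WF.
have W0 : weak_cayley_table_group G (E0 \o F).
  by apply: wct_comp => //; apply: (generated_wct hG).
have [E2 K2 [EF0 EF2]] := fix_rho2_coset hG W0 F0.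
have W2 : weak_cayley_table_group G (E2 \o (E0 \o F)).
  by apply: wct_comp => //; apply: (generated_wct hG).
have [E K1 EF] := fix_rho_coset hG W2 EF0 EF2.
apply: (bijection_group_cancel gp K0); apply: (bijection_group_cancel gp K2).
apply: (bijection_group_cancel gp K1).
have -> : E \o (E2 \o (E0 \o F)) = id by apply/funext.
by case: gp.
Qed.
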